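(* Let the $\sigma_n$-$k$-partition $P$ be a blow-up of the $\sigma_m$-$k$-partition $Q$. If $Q$ admits a transitive $\sigma_m$-orientation, then $P$ admits a transitive $\sigma_n$-orientation.
   Context: For an integer $n>1$, $K_n$ is the complete graph on the vertex set $[n]=\{0,1,\dots,n-1\}$; vertices are considered as residue classes modulo $n$, and $\sigma_n$ is the cyclic permutation of $[n]$ with $\sigma_n(i)=i+1$ (mod $n$), acting also on edges, graphs and digraphs. For an integer $k>1$, a $\sigma_n$-$k$-partition is a partition of the edge set of $K_n$ into subgraphs $F_0,\dots,F_{k-1}$ with $\sigma_n(F_d)=F_{d+1}$ for $0\le d<k-1$. (This forces $k\mid n$, and $2k\mid n$ if $k$ is even; also $\sigma_n(F_{k-1})=F_0$.) The label of an edge $e\in F_d$ is $\ell(e)=d$. The defining sequence of the partition is $a_1,\dots,a_{\lfloor n/2\rfloor}$ with $a_i=\ell(\{0,i\})\in\{0,\dots,k-1\}$. The defining sequence uniquely determines the partition. A transitive orientation $T$ of $K_n$ (i.e. a transitive tournament on $[n]$) is a transitive $\sigma_n$-orientation of the $\sigma_n$-$k$-partition if $\sigma_n(\vec F_d)=\vec F_{d+1}$ for $0\le d<k-1$, where $\vec F_d$ is the orientation of $F_d$ obtained as a subgraph of $T$. The same definitions are used with $m$ in place of $n$. Blow-up: let $k>1$, let $m$ be such that $\sigma_m$-$k$-partitions exist (that is, $m$ is a multiple of $k$, and if $k$ is even $m$ is also a multiple of $2k$), and let $n$ be a multiple of $m$. Let $Q$ be a $\sigma_m$-$k$-partition with defining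 sequence $b_1,\dots,b_{\lfloor m/2\rfloor}$, and extend this sequence by setting $b_i=(b_{m-i}+i)\bmod k$ for $\lfloor m/2\rfloor<i<m$ (so $b_i$ is the label of the edge $\{0,i\}$ in $Q$ for every $1\le i<m$). A $\sigma_n$-$k$-partition $P$ with defining sequence $a_1,\dots,a_{\lfloor n/2\rfloor}$ is a blow-up of $Q$ if $a_i=b_{(i\bmod m)}$ whenever $1\le i\le\lfloor n/2\rfloor$ and $i$ is not divisible by $m$ (there is no requirement on $a_i$ when $m\mid i$). *)

(* Defs.v *)
From mathcomp Require Import all_boot.

Set Implicit Arguments.
Unset Strict Implicit.
Unset Printing Implicit Defensive.

Section SigmaPartitions.

Variables k n : nat.

(* Graphs on [n] are represented by their edge sets, digraphs by their arc    *)
(* sets; ordS is the cyclic permutation i |-> i + 1 (mod n) of 'I_n.          *)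
Definition sigma_graph (F : {set {set 'I_n}}) : {set {set 'I_n}} :=
  [set [set ordS v | v in e] | e : {set 'I_n} in F].

Definition sigma_digraph (D : {set 'I_n * 'I_n}) : {set 'I_n * 'I_n} :=
  [set (ordS a.1, ordS a.2) | a in D].

Definition complete_graph : {set {set 'I_n}} := [set e : {set 'I_n} | #|e| == 2].

Definition is_sigma_partition (F : 'I_k -> {set {set 'I_n}}) : Prop :=
  [/\ partition [set F d | d : 'I_k] complete_graph,
      injective F &
      forall d d' : 'I_k, d' = d.+1 :> nat -> sigma_graph (F d) = F d'].

(* The index of the part containing e (the junk value k if there is none).    *)
Definition label (F : 'I_k -> {set {set 'I_n}}) (e : {set 'I_n}) : nat :=
  find (fun d : 'I_k => e \in F d) (enum 'I_k).

(* The edge {0, i}, for 0 < i < n.                                            *)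
Definition edge0 (i : nat) : {set 'I_n} :=
  [set v : 'I_n | (v == 0 :> nat) || (v == i :> nat)].

(* Meaningful for 1 <= i <= n./2.                                             *)
Definition defining_seq (F : 'I_k -> {set {set 'I_n}}) (i : nat) : nat :=
  label F (edge0 i).

(* Meaningful for 1 <= i < n.                                                 *)
Definition extended_seq (F : 'I_k -> {set {set 'I_n}}) (i : nat) : nat :=
  if i <= n./2 then defining_seq F i
  else (defining_seq F (n - i) + i) %% k.

Definition transitive_tournament (T : rel 'I_n) : Prop :=
  [/\ irreflexive T,
      forall u v : 'I_n, u != v -> T u v = ~~ T v u &
      transitive T].

Definition oriented_part (T : rel 'I_n) (F : {set {set 'I_n}}) :
    {set 'I_n * 'I_n} :=
  [set a : 'I_n * 'I_n | T a.1 a.2 && ([set a.1; a.2] \in F)].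

Definition is_transitive_sigma_orientation
    (F : 'I_k -> {set {set 'I_n}}) (T : rel 'I_n) : Prop :=
  transitive_tournament T /\
  forall d d' : 'I_k, d' = d.+1 :> nat ->
    sigma_digraph (oriented_part T (F d)) = oriented_part T (F d').

End SigmaPartitions.

Definition is_blow_up (k m n : nat) (Q : 'I_k -> {set {set 'I_m}})
    (P : 'I_k -> {set {set 'I_n}}) : Prop :=
  forall i : nat, 1 <= i <= n./2 -> ~~ (m %| i) ->
    defining_seq P i = extended_seq Q (i %% m).

(* Main.v *)
Require Import Defs.
From mathcomp Require Import all_boot zify.

Set Implicit Arguments.
Unset Strict Implicit.
Unset Printing Implicit Defensive.

(** Why the theorem is true.

    A step of the rotation sigma increases labels by 1 modulo k, also from
    k - 1 back to 0 ([label_shift]); hence k divides the number of vertices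
    ([dvdn_parts]) and the label of an edge {i, i + j} is the label of
    {0, j} plus i, modulo k ([edge_label_add]).  A transitive tournament is a
    transitive sigma-orientation exactly when sigma preserves the direction of
    every edge whose label is not k - 1 ([sigma_orientationP]).

    Let T be a transitive orientation for Q.  An edge {u, v} of K_n with
    u <> v modulo m has in P the label that its reduction modulo m has in Q
    ([blow_up_edge_label]), so such edges can be oriented like their reductions
    in T.  The result is a lexicographic order over T, and what remains is to
    order each residue class modulo m so that sigma reverses only edges
    labelled k - 1.

    Put n = s m.  For i < j < n with j = i + d m, direct the edge from i to j
    when i < U d and from j to i otherwise, for a suitable sequence U of
    thresholds.  Geometrically, the n vertices travel along a common closed
    trajectory which first rises and then falls: two vertices at a given
    distance meet at a single height, and U d says where.  The tournament is
    transitive as soon as U d is nonincreasing and U d + d m is nondecreasing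
    in d ([threshold_trans]).  If moreover 0 < U d <= n - d m, the rotation
    reverses {i, i + d m} only when i + 1 = U d, and the edges that wrap around
    at n - 1 follow the same rule ([threshold_step]).  The reversed edge has
    label k - 1 exactly when U d is opposite to the label of {0, d m} modulo k.
    Since only the class of U d modulo k is prescribed, such thresholds are
    found by decreasing recursion on d: each increment can be taken between
    1 and k, and k <= m ([threshold_seq_exists]). *)

(** * Residue classes as vertices *)

(** The residue class of i modulo n, as a vertex of K_n. *)
Definition cls n (n_gt0 : 0 < n) (i : nat) : 'I_n := Ordinal (ltn_pmod i n_gt0).

Lemma eq_cls n (n_gt0 : 0 < n) i j :
  (cls n_gt0 i == cls n_gt0 j) = (i == j %[mod n]).
Proof. by []. Qed.

Lemma cls_val n (n_gt0 : 0 < n) (u : 'I_n) : cls n_gt0 u = u.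
Proof. by apply: val_inj; rewrite /= modn_small. Qed.

Lemma ordS_cls n (n_gt0 : 0 < n) i : ordS (cls n_gt0 i) = cls n_gt0 i.+1.
Proof. by apply: val_inj; rewrite /= -addn1 modnDml addn1. Qed.

(** * Labels of a cyclic partition *)

Section Labels.

Variables (k n : nat) (F : 'I_k -> {set {set 'I_n}}).
Hypotheses (n_gt0 : 0 < n) (hF : is_sigma_partition F).

Lemma sigma_partition_ex (e : {set 'I_n}) : #|e| = 2 -> exists d, e \in F d.
Proof.
case: hF => /and3P[/eqP covF _ _] _ _ e2.
have : e \in complete_graph n by rewrite inE e2.
by rewrite -covF => /bigcupP[_ /imsetP[d _ ->] eFd]; exists d.
Qed.

Lemma sigma_partition_uniq (e : {set 'I_n}) d d' :
  e \in F d -> e \in F d' -> d = d'.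
Proof.
case: hF => /and3P[_ /trivIsetP triv _] injF _ eF eF'.
apply/eqP; apply: contraT => neq.
have := triv (F d) (F d') (imset_f _ isT) (imset_f _ isT).
by rewrite (inj_eq injF) => /(_ neq) /disjointFr -/(_ _ eF); rewrite eF'.
Qed.

Lemma mem_part (e : {set 'I_n}) d : #|e| = 2 -> (e \in F d) = (label F e == d).
Proof.
move=> /sigma_partition_ex[d0 eFd0].
have -> : label F e = d0.
  rewrite /label (eq_find (a2 := pred1 d0)) => [|d1 /=]; last first.
    apply/idP/eqP => [eFd1|-> //]; exact: sigma_partition_uniq eFd1 eFd0.
  by rewrite -[find _ _]/(index d0 (enum 'I_k)) index_enum_ord.
apply/idP/eqP => [eFd|/val_inj <- //].
by congr val; apply: sigma_partition_uniq eFd0 eFd.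
Qed.

Lemma label_lt (e : {set 'I_n}) : #|e| = 2 -> label F e < k.
Proof.
move=> e2; have [d] := sigma_partition_ex e2.
by rewrite mem_part // => /eqP->.
Qed.

Lemma card_shift (e : {set 'I_n}) : #|[set ordS v | v in e]| = #|e|.
Proof. exact: card_imset (@ordS_inj n). Qed.

(** The equation holds for every label, including k - 1, although the
    definition of a sigma-partition only relates the parts F d and F (d + 1)
    for d < k - 1. *)
Lemma label_shift (e : {set 'I_n}) :
  #|e| = 2 -> label F [set ordS v | v in e] = (label F e).+1 %% k.
Proof.
move=> e2; have lk := label_lt e2; set e' := [set _ | _ in _].
have e'2 : #|e'| = 2 by rewrite card_shift.
have l'k := label_lt e'2.
have [_ _ sigF] := hF.
have eF : e \in F (Ordinal lk) by rewrite mem_part.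
case: (ltnP (label F e).+1 k) => [lk1|].
  rewrite modn_small //.
  have : e' \in sigma_graph (F (Ordinal lk)) by apply: imset_f.
  by rewrite (sigF _ (Ordinal lk1)) // mem_part // => /eqP.
move=> kl; have -> : (label F e).+1 = k by apply/eqP; rewrite eqn_leq lk.
rewrite modnn; apply/eqP; apply: contraT; rewrite -lt0n => l'0.
(* The part containing e' is the image of the preceding part, so e' would be
   the image of an edge with a smaller label than e. *)
have plk : (label F e').-1 < k by lia.
have : e' \in F (Ordinal l'k) by rewrite mem_part.
rewrite -(sigF (Ordinal plk)) /=; last lia.
case/imsetP => e1 e1F /imset_inj e1e.
have {}e1e : e = e1 by apply: e1e; apply: ordS_inj.
by move: e1F; rewrite -e1e mem_part //= => /eqP; lia.
Qed.

(** The label of the edge joining the classes of the integers i and j modulo n.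
    Taking arbitrary natural numbers as arguments makes rotations plain
    additions, and allows labels modulo m and modulo n to be compared. *)
Definition edge_label (i j : nat) : nat :=
  label F [set cls n_gt0 i; cls n_gt0 j].

Lemma edge_labelC i j : edge_label i j = edge_label j i.
Proof. by rewrite /edge_label setUC. Qed.

Lemma edge_label_val (u v : 'I_n) : edge_label u v = label F [set u; v].
Proof. by rewrite /edge_label !cls_val. Qed.

Lemma edge_label_modl i j l :
  i = j %[mod n] -> edge_label i l = edge_label j l.
Proof.
by move=> /eqP; rewrite -(eq_cls n_gt0) /edge_label => /eqP->.
Qed.

Lemma edge_label_modr i j l :
  i = j %[mod n] -> edge_label l i = edge_label l j.
Proof. by rewrite ![edge_label l _]edge_labelC; apply: edge_label_modl. Qed.

Lemma card_edge i j :
  i != j %[mod n] -> #|[set cls n_gt0 i; cls n_gt0 j]| = 2.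
Proof. by rewrite -(eq_cls n_gt0) cards2 => ->. Qed.

Lemma edge_label_lt i j : i != j %[mod n] -> edge_label i j < k.
Proof. by move=> neq; apply: label_lt; apply: card_edge. Qed.

Lemma edge_label_add i j t : i != j %[mod n] ->
  edge_label (i + t) (j + t) = (edge_label i j + t) %% k.
Proof.
move=> neq; elim: t => [|t IHt].
  by rewrite !addn0 modn_small // edge_label_lt.
transitivity ((edge_label (i + t) (j + t)).+1 %% k).
  rewrite -label_shift ?card_edge ?eqn_modDr //.
  by rewrite imsetU !imset_set1 !ordS_cls !addnS.
by rewrite IHt -addn1 modnDml addn1 addnS.
Qed.

(** Rotating the edge {0, 1} by n steps gives back the same edge, with its label
    increased by n modulo k. *)
Lemma dvdn_parts : 1 < n -> k %| n.
Proof.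
move=> n_gt1.
have neq : 0 != 1 %[mod n] by rewrite mod0n modn_small.
have := edge_label_add n neq.
rewrite (edge_label_modl _ (_ : 0 + n = 0 %[mod n])) ?add0n ?modnn ?mod0n //.
rewrite edge_labelC (edge_label_modl _ (_ : 1 + n = 1 %[mod n])) ?modnDr //.
rewrite edge_labelC => eql; have lk := edge_label_lt neq.
have : edge_label 0 1 + 0 == edge_label 0 1 + n %[mod k].
  by rewrite addn0 -eql modn_small.
by rewrite eqn_modDl mod0n eq_sym.
Qed.

Lemma defining_seqE i : i < n -> defining_seq F i = edge_label 0 i.
Proof.
move=> i_n; congr label; apply/setP => v.
by rewrite !inE -!val_eqE /= mod0n (modn_small i_n).
Qed.

Lemma extended_seqE i : 0 < i < n -> extended_seq F i = edge_label 0 i.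
Proof.
case/andP=> i_gt0 i_n; rewrite /extended_seq.
case: leqP => i_half; first exact: defining_seqE.
have neq : 0 != n - i %[mod n] by rewrite mod0n modn_small; lia.
rewrite defining_seqE ?ltn_subrL ?i_gt0 // -edge_label_add // add0n.
rewrite subnK 1?ltnW // edge_labelC.
by apply: edge_label_modl; rewrite modnn mod0n.
Qed.

(** * Orientations and blow-ups in terms of labels *)

(** A single condition on edges replaces the equations between oriented parts:
    sigma preserves the direction of the edges whose label is not k - 1. *)
Lemma sigma_orientationP (T : rel 'I_n) : transitive_tournament T ->
  is_transitive_sigma_orientation F T <->
  (forall u v : 'I_n, u != v -> (label F [set u; v]).+1 < k ->
     T (ordS u) (ordS v) = T u v).
Proof.
move=> trT; have [irr tot _] := trT.
have imS (u v : 'I_n) : [set ordS w | w in [set u; v]] = [set ordS u; ordS v].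
  by rewrite imsetU !imset_set1.
split=> [[_ sigT] u v neq lk|sigT].
- have fwd (x y : 'I_n) : x != y -> (label F [set x; y]).+1 < k ->
      T x y -> T (ordS x) (ordS y).
    move=> xy xyk Txy; have e2 : #|[set x; y]| = 2 by rewrite cards2 xy.
    have : (x, y) \in oriented_part T (F (Ordinal (ltnW xyk))).
      by rewrite inE Txy mem_part /=.
    move/(imset_f (fun a => (ordS a.1, ordS a.2))).
    rewrite -/(sigma_digraph _) (sigT _ (Ordinal xyk)) //.
    by rewrite inE /= => /andP[].
  have Sneq : ordS u != ordS v by rewrite (inj_eq (@ordS_inj n)).
  case Tuv: (T u v); first exact: fwd.
  have Tvu : T v u by rewrite tot 1?eq_sym // Tuv.
  by rewrite tot // fwd // 1?eq_sym // setUC.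
split=> // d d' dd'; apply/setP => -[x y].
apply/imsetP/idP => [[[u v]]|].
  rewrite inE /= => /andP[Tuv uvF] [-> ->].
  have neq : u != v by apply: contraTneq Tuv => ->; rewrite irr.
  have e2 : #|[set u; v]| = 2 by rewrite cards2 neq.
  move: uvF; rewrite mem_part // => /eqP uvd.
  rewrite inE /= sigT //; last by rewrite uvd -dd'.
  rewrite Tuv -imS mem_part ?card_shift // label_shift // uvd -dd'.
  by rewrite modn_small ?eqxx // dd'.
rewrite inE /= => /andP[].
have [[u ->] [v ->]] : (exists u, x = ordS u) /\ (exists v, y = ordS v).
  by split; [exists (ord_pred x)|exists (ord_pred y)]; rewrite ord_predK.
move=> TSuv; have neq : u != v.
  by apply: contraTneq TSuv => ->; rewrite irr.
have e2 : #|[set u; v]| = 2 by rewrite cards2 neq.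
rewrite -imS mem_part ?card_shift // label_shift // => /eqP uvd'.
have uvd : label F [set u; v] = d.
  have lk := label_lt e2; have d'k := ltn_ord d'.
  move: uvd'; rewrite dd'.
  case: (ltnP (label F [set u; v]).+1 k) => lk1.
    by rewrite modn_small // => -[].
  have -> : (label F [set u; v]).+1 = k by lia.
  by rewrite modnn.
exists (u, v) => //; rewrite inE /= mem_part // uvd eqxx andbT.
by rewrite -sigT // uvd -dd'.
Qed.

End Labels.

(** The definition of a blow-up concerns the edges {0, i} with i <= n / 2 only;
    rotations carry the equality over to all edges between distinct classes
    modulo m. *)
Lemma blow_up_edge_label k m n (m_gt1 : 1 < m) (n_gt1 : 1 < n)
    (Q : 'I_k -> {set {set 'I_m}}) (P : 'I_k -> {set {set 'I_n}})
    (hQ : is_sigma_partition Q) (hP : is_sigma_partition P) (u v : 'I_n) :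
  m %| n -> is_blow_up Q P -> u != v %[mod m] ->
  edge_label P (ltnW n_gt1) u v = edge_label Q (ltnW m_gt1) u v.
Proof.
move=> dvd_mn hPQ.
have base i j : 0 < j <= n./2 -> ~~ (m %| j) ->
    edge_label P (ltnW n_gt1) i (i + j) = edge_label Q (ltnW m_gt1) i (i + j).
  move=> jn mj; have j_n : j < n by lia.
  have jmod : 0 < j %% m < m by rewrite lt0n -/(dvdn m j) mj ltn_pmod // ltnW.
  have neqn : 0 != j %[mod n] by rewrite mod0n modn_small; lia.
  have neqm : 0 != j %[mod m] by rewrite mod0n eq_sym.
  have eq0 : edge_label P (ltnW n_gt1) 0 j = edge_label Q (ltnW m_gt1) 0 j.
    rewrite -defining_seqE // hPQ // (extended_seqE (ltnW m_gt1) hQ) //.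
    by apply: edge_label_modr; rewrite modn_mod.
  by rewrite addnC -{1 3}[i]add0n !edge_label_add // eq0.
wlog lt_uv : u v / u < v.
  move=> IH neq; case: (ltngtP u v) => [lt|lt|eq]; first exact: IH.
    by rewrite edge_labelC [RHS]edge_labelC IH // eq_sym.
  by rewrite eq eqxx in neq.
move=> neq.
have ndvd : ~~ (m %| v - u) by rewrite -eqn_mod_dvd 1?eq_sym // ltnW.
have v_n := ltn_ord v.
(* The edge {u, v} is also {v, v + (n - (v - u))}, the short way round. *)
have eqn : v + (n - (v - u)) = u + n by move: lt_uv v_n; clear; lia.
have le_n : v - u < n by apply: leq_ltn_trans (leq_subr _ _) v_n.
case: (leqP (v - u) n./2) => [small|large].
  by rewrite -[nat_of_ord v](subnKC (ltnW lt_uv)) base // subn_gt0 lt_uv.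
have ndvd' : ~~ (m %| n - (v - u)) by rewrite dvdn_subr // ltnW.
have le_half : 0 < n - (v - u) <= n./2.
  rewrite subn_gt0 le_n leq_subLR -[X in X <= _](odd_double_half n) -addnn.
  by rewrite addnA leq_add2r (leq_trans _ large) // -add1n leq_add2r leq_b1.
rewrite (edge_label_modl P _ _ (_ : u = u + n %[mod n])) ?modnDr //.
rewrite (edge_label_modl Q _ _ (_ : u = u + n %[mod m])); last first.
  by rewrite -modnDmr (eqP dvd_mn) addn0.
by rewrite edge_labelC [RHS]edge_labelC -eqn base.
Qed.

(** * Ordering a residue class by thresholds *)

Section ThresholdOrder.

Variables (m : nat) (U : nat -> nat).

(** For i < j, the edge at distance d = (j - i) / m goes from i to j when
    i < U d, and from j to i otherwise.  The relation is meant for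
    i = j modulo m, where the division is exact. *)
Definition threshold_rel (i j : nat) : bool :=
  (i < j) && (i < U ((j - i) %/ m)) || (j < i) && (U ((i - j) %/ m) <= j).

Lemma threshold_irr i : threshold_rel i i = false.
Proof. by rewrite /threshold_rel ltnn. Qed.

Lemma threshold_total i j : i != j -> threshold_rel i j = ~~ threshold_rel j i.
Proof. by rewrite /threshold_rel; case: ltngtP => //=; lia. Qed.

Hypotheses (m_gt0 : 0 < m)
  (U_anti : forall d e, U (d + e) <= U d)
  (U_lip : forall d e, U d <= U (d + e) + e * m).

Lemma threshold_trans i j l : i = j %[mod m] -> j = l %[mod m] ->
  threshold_rel i j -> threshold_rel j l -> threshold_rel i l.
Proof.
move=> ij jl; have il : i = l %[mod m] by rewrite ij.
rewrite (divn_eq i m) (divn_eq j m) (divn_eq l m) -jl -ij.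
move: (i %/ m) (j %/ m) (l %/ m) (i %% m) => x y z r {i j l ij jl il}.
have relE a b : threshold_rel (a * m + r) (b * m + r) =
    (a < b) && (a * m + r < U (b - a)) || (b < a) && (U (a - b) <= b * m + r).
  by rewrite /threshold_rel !ltn_add2r !ltn_pmul2r // !subnDr -!mulnBl !mulnK.
(* For a < b < c the hypotheses on U compare the thresholds of the three edges
   of a triangle; each of the relative orders of x, y, z uses one instance. *)
have facts a b c : a < b -> b < c ->
    [/\ U (c - a) <= U (b - a), U (c - a) <= U (c - b),
        U (b - a) + b * m <= U (c - a) + c * m &
        U (c - b) + a * m <= U (c - a) + b * m].
  move=> /ltnW ab /ltnW bc.
  have abm : a * m <= b * m by rewrite leq_mul2r ab orbT.
  have bcm : b * m <= c * m by rewrite leq_mul2r bc orbT.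
  have := U_anti (b - a) (c - b); have := U_anti (c - b) (b - a).
  have := U_lip (b - a) (c - b); have := U_lip (c - b) (b - a).
  have -> : c - b + (b - a) = c - a by lia.
  have -> : b - a + (c - b) = c - a by lia.
  by rewrite !mulnBl; split; lia.
rewrite !relE.
case: (ltngtP x y) => [xy|yx|->] //=; rewrite ?orbF.
- case: (ltngtP y z) => [yz|zy|<-] //=; rewrite ?orbF.
    have xz := ltn_trans xy yz; rewrite xz.
    by have [] := facts _ _ _ xy yz; lia.
  case: (ltngtP x z) => [xz|zx|<-] /=; rewrite ?orbF; last by lia.
    by have [] := facts _ _ _ xz zy; lia.
  by have [] := facts _ _ _ zx xy; lia.
- case: (ltngtP y z) => [yz|zy|<-] //=; rewrite ?orbF.
  + case: (ltngtP x z) => [xz|zx|<-] /=; rewrite ?orbF; last by lia.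
      by have [] := facts _ _ _ yx xz; lia.
    by have [] := facts _ _ _ yz zx; lia.
  + have zx := ltn_trans zy yx; rewrite zx.
    by have [] := facts _ _ _ zy yx; lia.
Qed.

Variable s : nat.
Hypothesis U_bounds : forall d, d < s -> 0 < U d <= (s - d) * m.

(** Rotation by one step reverses the edge {i, i + d m} only if i + 1 = U d.
    When j = s m - 1, its image is {0, i + 1}, at distance s - d, and the bounds
    on U (s - d) and on U d decide both directions. *)
Lemma threshold_step i j : i < j < s * m -> i = j %[mod m] ->
  U ((j - i) %/ m) != i.+1 ->
  threshold_rel (i.+1 %% (s * m)) (j.+1 %% (s * m)) = threshold_rel i j.
Proof.
case/andP=> ij jn /esym/eqP; rewrite eqn_mod_dvd 1?ltnW // => /dvdnP[d jid].
have d_gt0 : 0 < d by rewrite lt0n; apply/eqP => d0; rewrite d0 in jid; lia.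
have ds : d < s by rewrite -(ltn_pmul2r m_gt0); lia.
rewrite jid mulnK // => Udi.
have relE : threshold_rel i j = (i < U d).
  by rewrite /threshold_rel ij (ltnNge j) (ltnW ij) orbF jid mulnK.
rewrite relE (modn_small (_ : i.+1 < s * m)); last lia.
case: (ltnP j.+1 (s * m)) => [jn1|nj].
  rewrite modn_small // /threshold_rel !ltnS ij (ltnNge j) (ltnW ij) orbF.
  by rewrite subSS jid mulnK //; lia.
have -> : j.+1 = s * m by apply/eqP; rewrite eqn_leq jn.
rewrite modnn /threshold_rel /= subn0.
have i1E : i.+1 = (s - d) * m by rewrite mulnBl; lia.
have sds : s - d < s by lia.
rewrite i1E mulnK // leqNgt; have /andP[-> _] := U_bounds sds.
by have /andP[_] := U_bounds ds; lia.
Qed.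

End ThresholdOrder.

(** The residue of U d modulo k is prescribed by c d.  Since k <= m, consecutive
    thresholds with the required residues can be chosen to differ by at
    most m. *)
Lemma threshold_seq_exists k m s (c : nat -> nat) : 0 < k <= m ->
  exists U : nat -> nat,
    [/\ forall d e, U (d + e) <= U d,
        forall d e, U d <= U (d + e) + e * m,
        forall d, d < s -> 0 < U d <= (s - d) * m &
        forall d, 0 < d < s -> k %| c d + U d].
Proof.
case/andP=> k_gt0 le_km.
(* W e is the threshold for d = s - e.  The increment lies between 1 and k, and
   makes k divide c (s - e) + W e. *)
pose W := fix W e :=
  if e is e'.+1 then W e' + (k - (c (s - e) + W e') %% k) else 0.
have Wstep e : W e < W e.+1 <= W e + m.
  by have /= := ltn_pmod (c (s - e.+1) + W e) k_gt0; lia.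
have Wlab e : k %| c (s - e.+1) + W e.+1.
  rewrite /= addnA {1}(divn_eq (c _ + W e) k) -addnA subnKC.
    by rewrite dvdn_addl ?dvdn_mull.
  by rewrite ltnW // ltn_pmod.
have Wadd d e : W d <= W (d + e) <= W d + e * m.
  elim: e => [|e IHe]; first by rewrite addn0; lia.
  by rewrite addnS mulSn; have := Wstep (d + e); lia.
have Wsub d e : W (s - (d + e)) <= W (s - d) <= W (s - (d + e)) + e * m.
  have le_e : (s - d - (s - (d + e))) * m <= e * m.
    by rewrite leq_mul2r; apply/orP; right; lia.
  have := Wadd (s - (d + e)) (s - d - (s - (d + e))).
  by rewrite subnKC; lia.
exists (fun d => W (s - d)); split=> [d e|d e|d ds|d ds].
- by have /andP[] := Wsub d e.
- by have /andP[] := Wsub d e.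
- have := Wadd 0 (s - d); have := Wstep (s - d.+1).
  by rewrite add0n subnSK //=; lia.
- have := Wlab (s - d.+1); rewrite subnSK; last lia.
  by rewrite subKn //; lia.
Qed.

Theorem theorem4 (k m n : nat) (hk : 1 < k) (hm : 1 < m) (hn : 1 < n)
    (hmn : m %| n)
    (Q : 'I_k -> {set {set 'I_m}}) (hQ : is_sigma_partition Q)
    (P : 'I_k -> {set {set 'I_n}}) (hP : is_sigma_partition P)
    (hPQ : is_blow_up Q P) :
  (exists T : rel 'I_m, is_transitive_sigma_orientation Q T) ->
  exists T : rel 'I_n, is_transitive_sigma_orientation P T.
Proof.
case=> T sigT; have trT := proj1 sigT; have [irrT totT transT] := trT.
set m_gt0 := ltnW hm; set n_gt0 := ltnW hn.
have {}sigT := proj1 (sigma_orientationP m_gt0 hQ trT) sigT.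
have dvd_km : k %| m := dvdn_parts m_gt0 hQ hm.
have km : 0 < k <= m by rewrite ltnW // dvdn_leq.
have [s n_sm] := dvdnP hmn.
have [U [U_anti U_lip U_bounds U_lab]] :=
  threshold_seq_exists s (fun d => edge_label P n_gt0 0 (d * m)) km.
(* T between distinct classes modulo m, thresholds inside a class. *)
pose T' (u v : 'I_n) :=
  if u == v %[mod m] then threshold_rel m U u v
  else T (cls m_gt0 u) (cls m_gt0 v).
have trT' : transitive_tournament T'.
  split=> [u|u v neq|v u w].
  - by rewrite /T' eqxx threshold_irr.
  - rewrite /T' [in RHS]eq_sym; case: ifP => uv; first exact: threshold_total.
    by rewrite totT // eq_cls uv.
  rewrite /T'; case: eqP => uv; case: eqP => vw.
  - by rewrite uv vw eqxx; apply: threshold_trans.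
  - rewrite uv; case: eqP => // _ _; congr (T _ _).
    by apply/eqP; rewrite eq_cls uv.
  - rewrite -vw; case: eqP => // _ + _; congr (T _ _).
    by apply/eqP; rewrite eq_cls vw.
  - move=> Tuv Tvw; have Tuw := transT _ _ _ Tuv Tvw.
    case: eqP => // /eqP; rewrite -(eq_cls m_gt0) => /eqP uw.
    by rewrite uw irrT in Tuw.
have [irrT' totT' _] := trT'.
exists T'; apply/(sigma_orientationP n_gt0 hP trT') => u v.
(* T' being a tournament, it suffices to treat the pairs with u < v. *)
wlog lt_uv : u v / u < v.
  move=> IH neq lk; case: (ltngtP u v) => [lt|lt|/val_inj eq].
  - exact: IH.
  - rewrite totT' ?(inj_eq (@ordS_inj n)) // [RHS]totT' //.
    by congr negb; apply: IH; rewrite 1?eq_sym // setUC.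
  - by rewrite eq eqxx in neq.
move=> neq; rewrite -(edge_label_val P n_gt0).
have modS (w : 'I_n) : ordS w = w.+1 %[mod m] by rewrite /= modn_dvdm.
have clsS (w : 'I_n) : cls m_gt0 (ordS w) = ordS (cls m_gt0 w).
  by rewrite ordS_cls; apply/eqP; rewrite eq_cls modS.
have eqmS : (ordS u == ordS v %[mod m]) = (u == v %[mod m]).
  by rewrite (modS u) (modS v) -(addn1 u) -(addn1 v) eqn_modDr.
rewrite /T' eqmS; case: ifP => [uv|uv].
  move=> lk; have := ltn_ord v; rewrite [X in _ < X]n_sm => vn.
  have -> : threshold_rel m U (ordS u) (ordS v) =
      threshold_rel m U (u.+1 %% (s * m)) (v.+1 %% (s * m)).
    by rewrite /= -n_sm.
  apply: threshold_step => //; [by rewrite lt_uv|exact/eqP|].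
  move: uv; rewrite eq_sym eqn_mod_dvd 1?ltnW // => /dvdnP[d vud].
  have dm_gt0 : 0 < d * m by rewrite -vud subn_gt0.
  have ds : 0 < d < s.
    move: dm_gt0; rewrite muln_gt0 => /andP[-> _] /=.
    by rewrite -(ltn_pmul2r m_gt0) -vud (leq_ltn_trans (leq_subr _ _)).
  rewrite vud mulnK //; apply: contraL lk => /eqP Udu.
  have := U_lab d ds; rewrite Udu addnS.
  have -> : edge_label P n_gt0 u v = (edge_label P n_gt0 0 (d * m) + u) %% k.
    rewrite -edge_label_add // ?add0n; last first.
      rewrite mod0n -vud modn_small ?neq_ltn ?subn_gt0 ?lt_uv //.
      exact: leq_ltn_trans (leq_subr u v) (ltn_ord v).
    by rewrite -vud subnK // ltnW.
  (* Here U d = u + 1, so k divides the label of {u, v} plus one. *)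
  set x := _ + u => kx; rewrite -leqNgt dvdn_leq //.
  by rewrite -addn1 /dvdn modnDml addn1.
rewrite (blow_up_edge_label hm hn hQ hP hmn hPQ (negbT uv)) => lk.
by rewrite !clsS sigT // eq_cls uv.
Qed.
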